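(* Let $\mathcal{M}_\theta$ be the set of $\theta$-restricted multisegments, equipped with the maps $\widetilde{F}_k:\mathcal{M}_\theta\to\{\text{formal }\mathbb{Z}\text{-linear combinations of segments}\}$, $\widetilde{E}_k:\mathcal{M}_\theta\to\{\text{formal }\mathbb{Z}\text{-linear combinations of segments}\}\sqcup\{0\}$ (where $0$ is an extra symbol different from the empty multisegment $\emptyset$) and $\varepsilon_k:\mathcal{M}_\theta\to\mathbb{Z}$, for $k\in I=\mathbb{Z}_{\mathrm{odd}}$, defined in the context. Then $\mathcal{M}_\theta$ is a crystal, namely, for every $k\in I$: (i) $\widetilde{F}_k\mathcal{M}_\theta\subset\mathcal{M}_\theta$ and $\widetilde{E}_k\mathcal{M}_\theta\subset\mathcal{M}_\theta\sqcup\{0\}$; (ii) $\widetilde{F}_k\widetilde{E}_k(\mathbf{m})=\mathbf{m}$ for $\mathbf{m}\in\mathcal{M}_\theta$ with $\widetilde{E}_k(\mathbf{m})\neq 0$, and $\widetilde{E}_k\circ\widetilde{F}_k=\mathrm{id}$; (iii) $\varepsilon_k(\mathbf{m})=\max\{n\ge 0 : \widetilde{E}_k^{\,n}(\mathbf{m})\neq 0\}<\infty$ for every $\mathbf{m}\in\mathcal{M}_\theta$ (with the convention $\widetilde{E}_k(0)=0$).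
   Context: Let $I=\mathbb{Z}_{\mathrm{odd}}$ be the set of odd integers. For $i\le j$ in $I$, the segment $\langle i,j\rangle$ is the interval $[i,j]\subset\mathbb{Z}_{\mathrm{odd}}$; write $\langle i\rangle=\langle i,i\rangle$. A multisegment is a formal finite sum $\mathbf{m}=\sum_{i\le j}m_{i,j}\langle i,j\rangle$ with $m_{i,j}\in\mathbb{Z}_{\ge0}$; the zero multisegment is denoted $\emptyset$. It is $\theta$-restricted if it has the form $\mathbf{m}=\sum_{-j\le i\le j}m_{i,j}\langle i,j\rangle$, i.e. $m_{i,j}=0$ unless $-j\le i\le j$. All indices below run over odd integers, coefficients $m_{i,j}$ not occurring in $\mathbf{m}$ are $0$, and $\delta(P)$ (or $\delta_P$) is $1$ if the condition $P$ holds and $0$ otherwise. **Operators for $k>0$.** For $\mathbf{m}\in\mathcal{M}_\theta$ and $\ell\ge k$ set $A^{(k)}_\ell(\mathbf{m})=\sum_{\ell'\ge\ell}(m_{k,\ell'}-m_{k+2,\ell'+2})$ and $\varepsilon_k(\mathbf{m})=\max\{A^{(k)}_\ell(\mathbf{m}):\ell\ge k\}\ge0$. - If $\varepsilon_k(\mathbf{m})=0$, then $\widetilde{E}_k(\mathbf{m})=0$. If $\varepsilon_k(\mathbf{m})>0$, let $n_e$ be the largest $\ell\ge k$ with $\varepsilon_k(\mathbf{m})=A^{(k)}_\ell(\mathbf{m})$ and set $\widetilde{E}_k(\mathbf{m})=\mathbf{m}-\langle k,n_e\rangle+\delta_{n_e\ne k}\langle k+2,n_e\rangle$. - Let $n_f$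 be the smallest $\ell\ge k$ with $\varepsilon_k(\mathbf{m})=A^{(k)}_\ell(\mathbf{m})$ and set $\widetilde{F}_k(\mathbf{m})=\mathbf{m}-\delta_{n_f\ne k}\langle k+2,n_f\rangle+\langle k,n_f\rangle$. **Operators for $-k$ with $k>0$.** For $\mathbf{m}\in\mathcal{M}_\theta$ set $$A^{(-k)}_\ell(\mathbf{m})=\sum_{\ell'\ge\ell}(m_{-k,\ell'}-m_{-k+2,\ell'+2})\quad(\ell>k),$$ $$A^{(-k)}_k(\mathbf{m})=\sum_{\ell>k}(m_{-k,\ell}-m_{-k+2,\ell})+2m_{-k,k}+\delta(m_{-k+2,k}\text{ is odd}),$$ $$A^{(-k)}_j(\mathbf{m})=\sum_{\ell>k}(m_{-k,\ell}-m_{-k+2,\ell})+2m_{-k,k}-2m_{-k+2,k-2}+\sum_{-k+2<i\le j+2}m_{i,k}-\sum_{-k+2<i\le j}m_{i,k-2}\quad(-k+2\le j\le k-2),$$ and $\varepsilon_{-k}(\mathbf{m})=\max\{A^{(-k)}_\ell(\mathbf{m})\}$, the maximum over all odd $\ell\ge -k+2$. Order the index set $\{\ell\in\mathbb{Z}_{\mathrm{odd}}:\ell\ge-k+2\}$ by $$\cdots>k+4>k+2>k>-k+2>-k+4>\cdots>k-2 .$$ - Let $n_f$ be the smallest index $\ell$ for this order with $\varepsilon_{-k}(\mathbf{m})=A^{(-k)}_\ell(\mathbf{m})$. Then $\widetilde{F}_{-k}(\mathbf{m})$ equals - $\mathbf{m}-\langle -k+2,n_f\rangle+\langle -k,n_f\rangle$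 if $n_f>k$ (as integers); - $\mathbf{m}-\langle -k+2,k\rangle+\langle -k,k\rangle$ if $n_f=k$ and $m_{-k+2,k}$ is odd; - $\mathbf{m}-\delta_{k\ne1}\langle -k+2,k-2\rangle+\langle -k+2,k\rangle$ if $n_f=k$ and $m_{-k+2,k}$ is even; - $\mathbf{m}-\delta_{n_f\ne k-2}\langle n_f+2,k-2\rangle+\langle n_f+2,k\rangle$ if $-k+2\le n_f\le k-2$ (as integers). - If $\varepsilon_{-k}(\mathbf{m})=0$, then $\widetilde{E}_{-k}(\mathbf{m})=0$. If $\varepsilon_{-k}(\mathbf{m})>0$, let $n_e$ be the largest index $\ell$, for the order $\cdots>k+4>k+2>k>-k+2>-k+4>\cdots>k-2$ on $\{\ell\in\mathbb{Z}_{\mathrm{odd}}:\ell\ge-k+2\}$, with $\varepsilon_{-k}(\mathbf{m})=A^{(-k)}_\ell(\mathbf{m})$. Then $\widetilde{E}_{-k}(\mathbf{m})$ equals - $\mathbf{m}-\langle -k,n_e\rangle+\langle -k+2,n_e\rangle$ if $n_e>k$; - $\mathbf{m}-\langle -k,k\rangle+\langle -k+2,k\rangle$ if $n_e=k$ and $m_{-k+2,k}$ is even; - $\mathbf{m}-\langle -k+2,k\rangle+\delta_{k\ne1}\langle -k+2,k-2\rangle$ if $n_e=k$ and $m_{-k+2,k}$ is odd; - $\mathbf{m}-\langle n_e+2,k\rangle+\delta_{n_e\ne k-2}\langle n_e+2,k-2\rangle$ if $-k+2\le n_e\le k-2$. *)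

(* Defs.v *)
From HB Require Import structures.
From mathcomp Require Import all_boot all_order all_algebra.
From mathcomp Require Import boolp classical_sets functions cardinality fsbigop.
From mathcomp Require Import freeg.

Set Implicit Arguments.
Unset Strict Implicit.
Unset Printing Implicit Defensive.

Import Order.TTheory GRing.Theory Num.Theory.

Local Open Scope classical_set_scope.
Local Open Scope ring_scope.

Definition oddz (x : int) : bool := odd `|x|%N.

Record segment := Segment {
  bounds : int * int;
  _ : [&& oddz bounds.1, oddz bounds.2 & bounds.1 <= bounds.2] }.

HB.instance Definition _ := [isSub for bounds].
HB.instance Definition _ := [Choice of segment by <:].

Notation lcomb := {freeg segment / int}.

(* The value 0 outside the segments is never significant: in the operators
   below, at indices n in the index set, [seg i j] with j < i only occurs
   multiplied by a vanishing delta. *)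
Definition seg (i j : int) : lcomb :=
  if insub (i, j) is Some s then << s >> else 0.

(* m_{i,j}, with value 0 when <i,j> is not a segment. *)
Definition mult (m : lcomb) (i j : int) : int :=
  if insub (i, j) is Some s then coeff s m else 0.

Definition multisegment : set lcomb :=
  [set m | forall s : segment, 0 <= coeff s m].

Definition theta_restricted : set lcomb :=
  [set m | forall s : segment,
     coeff s m != 0 -> - (bounds s).2 <= (bounds s).1].

Definition Mtheta : set lcomb := multisegment `&` theta_restricted.

Definition odd_ge (a : int) : set int := [set l | oddz l && (a <= l)].

(* Odd integers in the half-open interval ]a, b]. *)
Definition odd_oc (a b : int) : set int := [set l | oddz l && (a < l <= b)].

(* A^(k) for k > 0. *)
Definition Apos (k : int) (m : lcomb) (l : int) : int :=
  \sum_(l' \in odd_ge l) (mult m k l' - mult m (k + 2) (l' + 2)).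

(* A^(-k) for k > 0: here and in the other definitions with suffix [neg] the
   argument k is the absolute value of the index. *)
Definition Aneg (k : int) (m : lcomb) (l : int) : int :=
  if k < l then
    \sum_(l' \in odd_ge l) (mult m (- k) l' - mult m (- k + 2) (l' + 2))
  else if l == k then
    \sum_(l' \in odd_ge (k + 2)) (mult m (- k) l' - mult m (- k + 2) l')
    + 2 * mult m (- k) k + (oddz (mult m (- k + 2) k))%:R
  else
    \sum_(l' \in odd_ge (k + 2)) (mult m (- k) l' - mult m (- k + 2) l')
    + 2 * mult m (- k) k - 2 * mult m (- k + 2) (k - 2)
    + \sum_(i \in odd_oc (- k + 2) (l + 2)) mult m i k
    - \sum_(i \in odd_oc (- k + 2) l) mult m i (k - 2).

Definition A (k : int) : lcomb -> int -> int :=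
  if 0 < k then Apos k else Aneg (- k).

(* The index set of A^(k); for k < 0 its least element k + 2 is -|k| + 2. *)
Definition indices (k : int) : set int :=
  odd_ge (if 0 < k then k else k + 2).

(* The non-strict version of
   ... > k+4 > k+2 > k > -k+2 > -k+4 > ... > k-2. *)
Definition leneg (k : int) : rel int :=
  fun l l' => if k <= l' then l <= l' else l' <= l < k.

Definition leind (k : int) : rel int :=
  if 0 < k then fun l l' => l <= l' else leneg (- k).

(* The maximum, and below the extremal indices n_e and n_f, are chosen by
   [xget] as the elements with the defining property, which are unique; the
   default value 0 only matters if there is none. *)
Definition eps (k : int) (m : lcomb) : int :=
  xget 0 ((A k m @` indices k) `&` ubound (A k m @` indices k)).

Definition argmaxA (k : int) (m : lcomb) : set int :=
  [set l | indices k l /\ eps k m = A k m l].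

Definition ne (k : int) (m : lcomb) : int :=
  xget 0 [set l | argmaxA k m l /\ forall l', argmaxA k m l' -> leind k l' l].

Definition nf (k : int) (m : lcomb) : int :=
  xget 0 [set l | argmaxA k m l /\ forall l', argmaxA k m l' -> leind k l l'].

Definition Fpos (k n : int) (m : lcomb) : lcomb :=
  m - seg (k + 2) n *+ (n != k) + seg k n.

Definition Fneg (k n : int) (m : lcomb) : lcomb :=
  if k < n then m - seg (- k + 2) n + seg (- k) n
  else if n == k then
    if oddz (mult m (- k + 2) k) then m - seg (- k + 2) k + seg (- k) k
    else m - seg (- k + 2) (k - 2) *+ (k != 1) + seg (- k + 2) k
  else m - seg (n + 2) (k - 2) *+ (n != k - 2) + seg (n + 2) k.

Definition Ft (k : int) (m : lcomb) : lcomb :=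
  if 0 < k then Fpos k (nf k m) m else Fneg (- k) (nf k m) m.

Definition Epos (k n : int) (m : lcomb) : lcomb :=
  m - seg k n + seg (k + 2) n *+ (n != k).

Definition Eneg (k n : int) (m : lcomb) : lcomb :=
  if k < n then m - seg (- k) n + seg (- k + 2) n
  else if n == k then
    if oddz (mult m (- k + 2) k)
    then m - seg (- k + 2) k + seg (- k + 2) (k - 2) *+ (k != 1)
    else m - seg (- k) k + seg (- k + 2) k
  else m - seg (n + 2) k + seg (n + 2) (k - 2) *+ (n != k - 2).

(* [None] is the extra symbol 0, as opposed to the empty multisegment
   [Some 0]. *)
Definition Et (k : int) (m : lcomb) : option lcomb :=
  if 0 < eps k m then
    Some (if 0 < k then Epos k (ne k m) m else Eneg (- k) (ne k m) m)
  else None.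

Definition Et_iter (k : int) (n : nat) (m : lcomb) : option lcomb :=
  iter n (obind (Et k)) (Some m).

(* Main.v *)
Require Import Defs.
From mathcomp Require Import all_boot all_order all_algebra.
From mathcomp Require Import boolp classical_sets functions cardinality fsbigop.
From mathcomp Require Import freeg zify.

Import Order.TTheory GRing.Theory Num.Theory.

Local Open Scope classical_set_scope.
Local Open Scope ring_scope.

(** Fix [k] and enumerate the index set of [A k] by the natural numbers, in the
    increasing order that defines [ne] and [nf].  The whole structure then rests
    on one sequence of integers, [p |-> height k m p], the value of [A k m] at
    the [p]-th index.  It vanishes for large [p], and its consecutive differences
    have the form

      height p - height p.+1 = removable p - addable p.+1,

    where [removable p] measures how often the lowering operator can act at the
    [p]-th index and [addable p] how often the raising operator can
    ([height_step]).  This is the signature rule of a tensor product of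
    sl_2-crystals.  For negative [k] the index [-k] counts each segment
    <k,-k>, resp. <k+2,-k-2>, twice and adds the parity of the multiplicity of
    <k+2,-k>: the two half steps <k+2,-k-2> to <k+2,-k> to <k,-k> then both
    change the count by one.

    Letting the raising operator act at the [p]-th index, whether or not it is
    the index prescribed by [nf], adds one to [removable p] and, for [p > 0],
    subtracts one from [addable p].  By the difference formula it adds 2 to the heights before
    [p], 1 to the height at [p] and 0 to the later ones ([height_F_at]).  Hence
    [p] is the first maximum before the action exactly when it is the last
    maximum after it ([peak_shift]), and the maximum grows by one.  As the
    actions of the two operators at one and the same index are inverse to each
    other ([F_atK], [E_atK]), the global operators are inverse to each other and
    shift [eps] by one.

    Positivity comes from the difference formula too.  Just before a first
    maximum the height increases strictly, which forces [addable] to be positive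
    there, so that the segment to be replaced does occur; at a last maximum the
    height decreases strictly, which forces [removable] to be positive
    ([Mtheta_F_at], [Mtheta_E_at]). *)

Set Implicit Arguments.
Unset Strict Implicit.
Unset Printing Implicit Defensive.

(** * Odd integers *)

Lemma oddzN k : oddz (- k) = oddz k.
Proof. by rewrite /oddz abszN. Qed.

Lemma oddz_neg_gt0 k : oddz k -> (0 < k) = false -> 0 < - k.
Proof. by rewrite /oddz; lia. Qed.

Lemma oddz_succ l l' : oddz l -> oddz l' -> l < l' -> l + 2 <= l'.
Proof. by rewrite /oddz; lia. Qed.

Lemma oddzD2 l p : oddz l -> oddz (l + 2 * p%:Z).
Proof. by rewrite /oddz; lia. Qed.

(** * Multiplicities *)

Lemma mult_seg i j i' j' :
  mult (seg i j) i' j' =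
  [&& oddz i, oddz j, i <= j, i' == i & j' == j]%:Z.
Proof.
rewrite /mult /seg.
case: insubP => [s' Ps' vs'|nP]; last first.
  case: eqP => [ei|]; rewrite ?andbF //; case: eqP => [ej|]; rewrite ?andbF //.
  by subst; move: nP => /= /negbTE; rewrite !andbT => ->.
case: insubP => [s Ps vs|nP]; last first.
  rewrite coeff0; move: nP => /= /negbTE.
  by case: oddz; case: oddz; case: (i <= j).
rewrite coeffU mul1r -val_eqE /= vs vs' xpair_eqE ![_ == i]eq_sym ![_ == j]eq_sym.
by case/and3P: Ps => /= -> -> -> /=; rewrite natz.
Qed.

Lemma mult_segE i j i' j' : oddz i -> oddz j -> i <= j ->
  mult (seg i j) i' j' = ((i' == i) && (j' == j))%:Z.
Proof. by move=> io jo ij; rewrite mult_seg io jo ij. Qed.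

Lemma multD m m' i j : mult (m + m') i j = mult m i j + mult m' i j.
Proof. by rewrite /mult; case: insub => // s; rewrite coeffD. Qed.

Lemma multB m m' i j : mult (m - m') i j = mult m i j - mult m' i j.
Proof. by rewrite /mult; case: insub => // s; rewrite coeffB. Qed.

Lemma multMb m (b : bool) i j : mult (m *+ b) i j = b%:Z * mult m i j.
Proof.
case: b; rewrite ?mulr1n ?mul1r // mulr0n mul0r /mult.
by case: insub => // s; rewrite coeff0.
Qed.

Lemma mult_segMbE i j (b : bool) i' j' : oddz i -> oddz j -> (b -> i <= j) ->
  mult (seg i j *+ b) i' j' = [&& b, i' == i & j' == j]%:Z.
Proof.
move=> io jo; rewrite multMb.
case: b => /= [/(_ isT) ij|_]; last by rewrite mul0r.
by rewrite mul1r mult_segE.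
Qed.

Lemma mult_bounds m (s : segment) : mult m (bounds s).1 (bounds s).2 = coeff s m.
Proof. by rewrite /mult -surjective_pairing (valK s). Qed.

Lemma MthetaP m :
  Mtheta m <-> forall i j, 0 <= mult m i j /\ (mult m i j != 0 -> - j <= i).
Proof.
split=> [[m0 mt] i j|mP].
  rewrite /mult; case: insubP => [s _ vs|_]; last by rewrite eqxx.
  by split; [exact: m0|move/mt; rewrite vs].
by split=> s; rewrite /= -mult_bounds; have [] := mP (bounds s).1 (bounds s).2.
Qed.

Lemma mult_ge0 m i j : Mtheta m -> 0 <= mult m i j.
Proof. by move=> /MthetaP/(_ i j)[]. Qed.

Lemma mult_finite m :
  exists B : int, forall i j, mult m i j != 0 -> `|i| <= B /\ `|j| <= B.
Proof.
exists (\sum_(s <- dom m) (`|(bounds s).1| + `|(bounds s).2|)) => i j.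
rewrite /mult; case: insubP => // s _ vs; rewrite -mem_dom => sm.
rewrite (big_rem s) //= vs /=.
set rest := \sum_(y <- _) _.
have : 0 <= rest by apply: sumr_ge0 => y _; rewrite addr_ge0.
by move: rest => rest rest0; lia.
Qed.

(** * Sums over odd integers *)

(** A bound on the absolute value, rather than a finiteness statement, is stable
    under shifts and differences by linear arithmetic. *)
Definition finsupp (f : int -> int) :=
  exists B : int, forall l, f l != 0 -> `|l| <= B.

Lemma finite_itv (B : int) : finite_set [set l : int | `|l| <= B].
Proof.
apply: (@sub_finite_set _ _ [set` [seq i%:Z - B | i <- iota 0 (absz (2 * B)).+1]]).
  move=> l; rewrite /mkset => lB; apply/mapP; exists (absz (l + B)).
    by rewrite mem_iota; lia.
  by rewrite /=; lia.
exact: finite_seq.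
Qed.

(** The sets of indices may be infinite, so that splitting off a term relies on the
    finite support: over an infinite support a sum over a set is 0 by
    convention. *)
Lemma fsum_setU1 (f : int -> int) x (D D' : set int) :
  finsupp f -> (forall y, D' y <-> y = x \/ D y) -> ~ D x ->
  \sum_(l \in D') f l = f x + \sum_(l \in D) f l.
Proof.
move=> [B fB] D'E Dx.
pose S := [set l : int | `|l| <= B].
have S0 y : ~ S y -> f y = 0.
  by move=> Sy; apply/eqP; apply: contra_notT Sy => /fB.
have DS : finite_set (D `&` S) by apply/finite_setIr/finite_itv.
rewrite -(fsbig_widen (D `&` S) D); last 2 first.
- by move=> y [].
- by move=> y /= [Dy nDS]; apply: S0 => Sy; apply: nDS.
rewrite -(fsbig_widen ([set x] `|` (D `&` S)) D'); last 2 first.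
- by move=> y /= [->|[Dy _]]; apply/D'E; [left|right].
- move=> y /= [/D'E D'y nDS]; apply: S0 => Sy; apply: nDS.
  by case: D'y => [->|Dy]; [left|right].
by rewrite fsbigU0 ?fsbig_set1 // => y [/= -> []].
Qed.

Lemma odd_ge_step l (f : int -> int) : oddz l -> finsupp f ->
  \sum_(l' \in odd_ge l) f l' = f l + \sum_(l' \in odd_ge (l + 2)) f l'.
Proof.
move=> lo fs; apply: fsum_setU1 => //.
  move=> y; rewrite /odd_ge /=; split=> [/andP[yo ly]|[->|/andP[-> yl]]].
  - case: (eqVneq y l) => [->|yl]; [by left|right].
    by rewrite yo oddz_succ // lt_def yl.
  - by rewrite lo lexx.
  - by rewrite (le_trans _ yl) // lerDl.
by rewrite /odd_ge /= lo /=; lia.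
Qed.

Lemma odd_oc_step a l (f : int -> int) : oddz l -> a <= l -> finsupp f ->
  \sum_(i \in odd_oc a (l + 2)) f i = f (l + 2) + \sum_(i \in odd_oc a l) f i.
Proof.
move=> lo al fs; apply: fsum_setU1 => //; rewrite /odd_oc /=; last by lia.
move=> y; split=> [/and3P[yo ay yl]|[->|/and3P[-> ->]]]; last by lia.
  case: (eqVneq y (l + 2)) => [->|yn]; [left|right] => //.
  by move: yo lo; rewrite /oddz; lia.
by move: lo; rewrite /oddz; lia.
Qed.

Lemma odd_oc0 a (f : int -> int) : \sum_(i \in odd_oc a a) f i = 0.
Proof. by apply: fsbig1 => i; rewrite /odd_oc /=; lia. Qed.

Lemma finsupp_row m i : finsupp (mult m i).
Proof. by have [B mB] := mult_finite m; exists B => l /mB[]. Qed.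

Lemma finsupp_col m j : finsupp (mult m ^~ j).
Proof. by have [B mB] := mult_finite m; exists B => l /mB[]. Qed.

Lemma finsupp_shift f a : finsupp f -> finsupp (fun l => f (l + a)).
Proof. by move=> [B fB]; exists (B + `|a|) => l /fB; lia. Qed.

Lemma finsuppB f g : finsupp f -> finsupp g -> finsupp (fun l => f l - g l).
Proof.
move=> [B fB] [C gC]; exists (`|B| + `|C|) => l.
by have [->|/fB] := eqVneq (f l) 0; have [->|/gC] := eqVneq (g l) 0; lia.
Qed.

(** Two sequences with the same consecutive differences agree as soon as they
    agree far out; identities between tail sums are proved in this way. *)
Lemma vanishing_seq (u : nat -> int) :
  (exists N, forall p, (N <= p)%N -> u p = 0) ->
  (forall p, u p = u p.+1) -> forall p, u p = 0.
Proof.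
move=> [N uN] uS p; rewrite -(uN (N + p)%N) ?leq_addr //.
by elim: N {uN} => // N ->; rewrite addSn uS.
Qed.

Lemma odd_ge_sum_far f : finsupp f ->
  exists B : int, forall l, B < l -> \sum_(l' \in odd_ge l) f l' = 0.
Proof.
move=> [B fB]; exists `|B| => l Bl; apply: fsbig1 => i /andP[_ li].
by apply/eqP; apply: contraT => /fB; lia.
Qed.

(** Shifting the index in the subtracted terms moves the first of them out of the
    sum.  It compares the tail sum in [Aneg] at the index [k], which has no shift,
    with the one at the index [k + 2]. *)
Lemma odd_ge_sum_shift f g l : oddz l -> finsupp f -> finsupp g ->
  \sum_(l' \in odd_ge l) (f l' - g l') =
  \sum_(l' \in odd_ge l) (f l' - g (l' + 2)) - g l.
Proof.
move=> lo fs gs; pose s p := l + 2 * p%:Z.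
have h1 := finsuppB fs gs; have h2 := finsuppB fs (finsupp_shift 2 gs).
pose S1 l := \sum_(l' \in odd_ge l) (f l' - g l').
pose S2 l := \sum_(l' \in odd_ge l) (f l' - g (l' + 2)).
suff /(_ 0%N): forall p, S1 (s p) - S2 (s p) + g (s p) = 0.
  by rewrite /s mulr0 addr0 -/(S1 l) -/(S2 l); lia.
apply: vanishing_seq => [|p].
  have [B1 B1P] := odd_ge_sum_far h1; have [B2 B2P] := odd_ge_sum_far h2.
  have [B gB] := gs.
  exists (absz l + absz B1 + absz B2 + absz B).+1 => p Np.
  have g0 : g (s p) = 0 by apply/eqP; apply: contraT => /gB; rewrite /s; lia.
  by rewrite g0 /S1 B1P /S2 ?B2P /s ?subr0 ?addr0 //; lia.
have so : oddz (s p) by exact: oddzD2.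
have sS : s p.+1 = s p + 2 by rewrite /s; lia.
rewrite sS /S1 /S2 (odd_ge_step so h1) (odd_ge_step so h2).
set X := \sum_(_ \in _) _; set Y := \sum_(_ \in _) _.
by move: X Y => X Y; lia.
Qed.

(** * Consecutive differences of the functions A *)

Lemma Apos_step k m l : oddz l ->
  Apos k m l = mult m k l - mult m (k + 2) (l + 2) + Apos k m (l + 2).
Proof.
move=> lo; rewrite /Apos odd_ge_step //.
exact: finsuppB (finsupp_row _ _) (finsupp_shift 2 (finsupp_row _ _)).
Qed.

Lemma Aneg_step_gt k m l : oddz l -> k < l ->
  Aneg k m l = mult m (- k) l - mult m (- k + 2) (l + 2) + Aneg k m (l + 2).
Proof.
move=> lo kl; rewrite /Aneg kl (lt_trans kl) ?ltrDl // odd_ge_step //.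
exact: finsuppB (finsupp_row _ _) (finsupp_shift 2 (finsupp_row _ _)).
Qed.

Lemma Aneg_step_eq k m : oddz k ->
  Aneg k m k = 2 * mult m (- k) k + (oddz (mult m (- k + 2) k))%:Z
               - mult m (- k + 2) (k + 2) + Aneg k m (k + 2).
Proof.
move=> ko; rewrite /Aneg ltxx eqxx ltrDl /=.
rewrite odd_ge_sum_shift; [|by have := oddzD2 1 ko|exact: finsupp_row..].
set X := \sum_(_ \in _) _; move: X => X; case: oddz => /=; lia.
Qed.

Lemma Aneg_step_first k m : oddz k -> 1 < k ->
  Aneg k m (- k + 2) = mult m (- k + 4) k
    - (2 * mult m (- k + 2) (k - 2) + (oddz (mult m (- k + 2) k))%:Z)
    + Aneg k m k.
Proof.
move=> ko k1; rewrite /Aneg ltxx eqxx.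
have -> : k < - k + 2 = false by lia.
have -> : (- k + 2 == k) = false by lia.
have ao : oddz (- k + 2) by move: ko; rewrite /oddz; lia.
rewrite (odd_oc_step ao (lexx _) (finsupp_col m k)).
rewrite (odd_oc0 (- k + 2) (mult m ^~ k)) (odd_oc0 (- k + 2) (mult m ^~ (k - 2))).
have -> : - k + 2 + 2 = - k + 4 by lia.
set X := \sum_(_ \in _) _; move: X => X; case: oddz => /=; lia.
Qed.

Lemma Aneg_step_lt k m l : oddz k -> oddz l -> - k + 2 < l -> l < k ->
  Aneg k m l = mult m (l + 2) k - mult m l (k - 2) + Aneg k m (l - 2).
Proof.
move=> ko lo lk l1; rewrite /Aneg.
have -> : k < l = false by lia.
have -> : k < l - 2 = false by lia.
have -> : (l == k) = false by lia.
have -> : (l - 2 == k) = false by lia.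
have l2o : oddz (l - 2) by move: lo; rewrite /oddz; lia.
have -> : l - 2 + 2 = l by lia.
rewrite odd_oc_step //; [|lia|exact: finsupp_col].
have al : - k + 2 <= l - 2 by move: ko l2o; rewrite /oddz; lia.
have := odd_oc_step l2o al (finsupp_col m (k - 2)); rewrite subrK => ->.
lia.
Qed.

(** * Enumeration of the index sets *)

(** For [k < 0] the order lists first the [- k - 1] odd numbers of the interval
    from [k + 2] to [- k - 2], decreasing, and then the odd numbers from [- k]
    on, increasing. *)
Definition idx (k : int) (p : nat) : int :=
  if 0 < k then k + 2 * p%:Z
  else if p.+1%:Z < - k then - k - 2 - 2 * p%:Z else 2 * p%:Z + 2 + k.

Lemma idx_indices k p : oddz k -> indices k (idx k p).
Proof.
by rewrite /indices /idx /odd_ge /oddz /=; case: ifP => _; [|case: ifP]; lia.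
Qed.

Lemma idx_surj k l : oddz k -> indices k l -> exists p, l = idx k p.
Proof.
rewrite /indices /idx /odd_ge /oddz /=; case: ifP => k0 ko lk.
  by exists (absz (l - k)%R)./2; lia.
case: (ltP l (- k)) => lk'.
  by exists (absz (- k - 2 - l)%R)./2; rewrite ifT; lia.
by exists (absz (l - 2 - k)%R)./2; rewrite ifF; lia.
Qed.

Lemma leind_idx k p q : oddz k -> leind k (idx k p) (idx k q) = (p <= q)%N.
Proof.
move=> ko; rewrite /leind /idx; case: ifP => k0; first by lia.
rewrite /leneg; case: (ltP p.+1%:Z) => hp; case: (ltP q.+1%:Z) => hq.
- rewrite ifF; lia.
- rewrite ifT; lia.
- rewrite ifF; lia.
- rewrite ifT; lia.
Qed.

Lemma idx_inj k p q : oddz k -> (idx k p == idx k q) = (p == q).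
Proof.
move=> ko; apply/eqP/eqP => [e|-> //]; apply/eqP.
by rewrite eqn_leq -!(leind_idx _ _ ko) e leind_idx ?leqnn.
Qed.

Lemma oddz_idx k p : oddz k -> oddz (idx k p).
Proof. by move=> ko; have /andP[] := idx_indices p ko. Qed.

Lemma idx_pos_ge k p : 0 < k -> k <= idx k p.
Proof. by move=> k0; rewrite /idx k0; lia. Qed.

Lemma idx_neg_ge k p : (0 < k) = false -> k + 2 <= idx k p.
Proof. by move=> k0; rewrite /idx k0; case: ltP; lia. Qed.

Lemma leind_anti k p q : oddz k ->
  leind k (idx k p) (idx k q) -> leind k (idx k q) (idx k p) -> idx k p = idx k q.
Proof.
by move=> ko; rewrite !leind_idx // => pq qp; congr idx; apply/anti_leq/andP.
Qed.

(** * The functions A as signature sequences *)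

(** As in [Aneg], the argument [k] of [removable_neg] and of [addable_neg] is the
    absolute value of the index.  At [l = k] the lowering operator goes from
    <-k,k> to <-k+2,k> to <-k+2,k-2>.  Each <-k,k> leaves room for two such
    moves, each <-k+2,k-2> is the result of two, and a pair of segments <-k+2,k>
    counts for nothing, whence the factors 2 and the parity. *)
Definition removable_neg (k : int) (m : lcomb) (l : int) : int :=
  if k < l then mult m (- k) l
  else if l == k then 2 * mult m (- k) k + (oddz (mult m (- k + 2) k))%:Z
  else mult m (l + 2) k.

Definition addable_neg (k : int) (m : lcomb) (l : int) : int :=
  if k < l then mult m (- k + 2) l
  else if l == k then
    2 * mult m (- k + 2) (k - 2) + (oddz (mult m (- k + 2) k))%:Z
  else mult m (l + 2) (k - 2).

Definition removable (k : int) (m : lcomb) (l : int) : int :=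
  if 0 < k then mult m k l else removable_neg (- k) m l.

Definition addable (k : int) (m : lcomb) (l : int) : int :=
  if 0 < k then mult m (k + 2) l else addable_neg (- k) m l.

Lemma removable_ge0 k m l : Mtheta m -> 0 <= removable k m l.
Proof.
move=> mM; rewrite /removable /removable_neg.
by repeat case: ifP => _; rewrite ?addr_ge0 ?mulr_ge0 ?mult_ge0.
Qed.

Lemma addable_ge0 k m l : Mtheta m -> 0 <= addable k m l.
Proof.
move=> mM; rewrite /addable /addable_neg.
by repeat case: ifP => _; rewrite ?addr_ge0 ?mulr_ge0 ?mult_ge0.
Qed.

Definition height (k : int) (m : lcomb) (p : nat) : int := A k m (idx k p).

(** For [k < 0] the parity occurs in the height at the index [- k] only.  It is
    therefore a part of [removable] in the difference that follows this index
    and, being subtracted, of [addable] in the one that precedes it. *)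
Lemma height_step k m p : oddz k ->
  height k m p = removable k m (idx k p) - addable k m (idx k p.+1)
                 + height k m p.+1.
Proof.
move=> ko; rewrite /height /A /removable /addable.
have := idx_indices p ko; rewrite /indices /odd_ge /= => /andP[].
rewrite /idx; case: ifP => k0 io il.
  have -> : k + 2 * p.+1%:Z = k + 2 * p%:Z + 2 by lia.
  exact: Apos_step.
move: il io; rewrite /removable_neg /addable_neg.
have {k0}: 0 < - k by move: ko; rewrite /oddz; lia.
have {ko}: oddz (- k) by rewrite /oddz abszN.
move: (- k) (opprK k) => K <- Ko K0.
case: (ltgtP p.+1%:Z K) => pK.
- case: (ltP p.+2%:Z K) => pK2 il io.
  + have -> : K < K - 2 - 2 * p%:Z = false by lia.
    have -> : K < K - 2 - 2 * p.+1%:Z = false by lia.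
    have -> : (K - 2 - 2 * p%:Z == K) = false by lia.
    have -> : (K - 2 - 2 * p.+1%:Z == K) = false by lia.
    rewrite Aneg_step_lt //; try lia.
    have -> : K - 2 - 2 * p%:Z - 2 = K - 2 - 2 * p.+1%:Z by lia.
    by have -> : K - 2 - 2 * p.+1%:Z + 2 = K - 2 - 2 * p%:Z by lia.
  + (* [p] and [p.+1] are the ranks of [- K + 2] and [K]. *)
    have -> : 2 * p.+1%:Z + 2 - K = K by lia.
    have -> : K - 2 - 2 * p%:Z = - K + 2 by lia.
    have -> : K < - K + 2 = false by lia.
    have -> : (- K + 2 == K) = false by lia.
    have K1 : 1 < K by lia.
    rewrite ltxx eqxx (Aneg_step_first m Ko K1).
    by have -> : - K + 2 + 2 = - K + 4 by lia.
- move=> il io; have -> : (p.+2%:Z < K) = false by lia.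
  have -> : K < 2 * p%:Z + 2 - K by lia.
  have -> : K < 2 * p.+1%:Z + 2 - K by lia.
  rewrite Aneg_step_gt //; last by lia.
  by have -> : 2 * p.+1%:Z + 2 - K = 2 * p%:Z + 2 - K + 2 by lia.
- move=> il io; have -> : (p.+2%:Z < K) = false by lia.
  have -> : 2 * p%:Z + 2 - K = K by lia.
  have -> : 2 * p.+1%:Z + 2 - K = K + 2 by lia.
  by rewrite ltxx eqxx ltrDl /= Aneg_step_eq.
Qed.

Lemma height_eq0 k m : exists N, forall p, (N <= p)%N -> height k m p = 0.
Proof.
have h i j a : finsupp (fun l => mult m i l - mult m j (l + a)).
  exact: finsuppB (finsupp_row _ _) (finsupp_shift _ (finsupp_row _ _)).
have [B BP] := odd_ge_sum_far (h k (k + 2) 2).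
exists (absz B + 2 * absz k).+1 => p Np; rewrite /height /A /idx; case: ifP => k0.
  by apply: BP; lia.
rewrite ifF; last by lia.
by rewrite /Aneg ifT; [rewrite opprK; apply: BP|]; lia.
Qed.

(** * The operators with a prescribed index *)

(** The parity that governs the case distinction at the index [- k], for
    [k < 0]. *)
Definition parity (k : int) (m : lcomb) : bool := oddz (mult m (k + 2) (- k)).

(** What the raising operator adds at the index [n], a difference of segments; [b]
    is the parity of the multiplicity of <-k+2,k> before the addition. *)
Definition node_neg (k n : int) (b : bool) : lcomb :=
  if k < n then seg (- k) n - seg (- k + 2) n
  else if n == k then
    if b then seg (- k) k - seg (- k + 2) k
    else seg (- k + 2) k - seg (- k + 2) (k - 2) *+ (k != 1)
  else seg (n + 2) k - seg (n + 2) (k - 2) *+ (n != k - 2).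

Definition node (k n : int) (b : bool) : lcomb :=
  if 0 < k then seg k n - seg (k + 2) n *+ (n != k) else node_neg (- k) n b.

(** The lowering operator at [n] undoes an addition made when the parity was the
    opposite of the present one: adding the node at the index [- k] always
    changes the number of segments <k+2,-k> by one. *)
Definition F_at k n m := m + node k n (parity k m).
Definition E_at k n m := m - node k n (~~ parity k m).

Lemma Ft_F_at k m : Ft k m = F_at k (nf k m) m.
Proof.
rewrite /Ft /F_at /node /Fpos /Fneg /node_neg /parity opprK.
by do ?[case: ifP => _]; rewrite -addrA (addrC (- _)).
Qed.

Lemma Et_E_at k m :
  Et k m = if 0 < eps k m then Some (E_at k (ne k m) m) else None.
Proof.
rewrite /Et /E_at /node /Epos /Eneg /node_neg /parity opprK.
case: ifP => // _; congr Some.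
by case: oddz => /=; do ?[case: ifP => _]; rewrite opprB -addrA (addrC (- _)).
Qed.

(** * Effect of the operators on the heights *)

Lemma mult_node_pos k n b i j : oddz k -> oddz n -> 0 < k -> k <= n ->
  mult (node k n b) i j =
  ((i == k) && (j == n))%:Z - [&& n != k, i == k + 2 & j == n]%:Z.
Proof.
move=> ko no k0 kn; have ko2 : oddz (k + 2) by move: ko; rewrite /oddz; lia.
rewrite /node k0 multB mult_segE // mult_segMbE //.
by move=> nk; apply: oddz_succ => //; rewrite lt_def nk.
Qed.

Lemma mult_node_neg_gt k n b i j : oddz k -> oddz n -> k < n -> 0 < k ->
  mult (node_neg k n b) i j =
  ((i == - k) && (j == n))%:Z - ((i == - k + 2) && (j == n))%:Z.
Proof.
move=> ko no kn k0; rewrite /node_neg kn multB !mult_segE //; try lia.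
all: by move: ko; rewrite /oddz; lia.
Qed.

Lemma mult_node_neg_eq k b i j : oddz k -> 0 < k ->
  mult (node_neg k k b) i j =
  if b then ((i == - k) && (j == k))%:Z - ((i == - k + 2) && (j == k))%:Z
  else ((i == - k + 2) && (j == k))%:Z
       - [&& k != 1, i == - k + 2 & j == k - 2]%:Z.
Proof.
move=> ko k0; rewrite /node_neg ltxx eqxx.
have ko1 : oddz (- k) by rewrite /oddz abszN.
have ko2 : oddz (- k + 2) by move: ko; rewrite /oddz; lia.
have ko3 : oddz (k - 2) by move: ko; rewrite /oddz; lia.
case: b; rewrite multB !mult_segE // ?mult_segMbE //; move: ko; rewrite /oddz; lia.
Qed.

Lemma mult_node_neg_lt k n b i j : oddz k -> oddz n -> - k + 2 <= n -> n < k ->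
  mult (node_neg k n b) i j =
  ((i == n + 2) && (j == k))%:Z - [&& n != k - 2, i == n + 2 & j == k - 2]%:Z.
Proof.
move=> ko no kn nk; rewrite /node_neg (lt_gtF nk) (lt_eqF nk).
rewrite multB mult_segE ?mult_segMbE //; move: ko no; rewrite /oddz; lia.
Qed.

(** At [n = l = k] the move either takes <-k+2,k> to <-k,k>, so that [removable]
    changes by [2 - 1], or creates <-k+2,k> when their number is even, so that it
    changes by 1. *)
Lemma removable_neg_node k m n l :
  oddz k -> oddz n -> oddz l -> 0 < k -> - k + 2 <= n -> - k + 2 <= l ->
  removable_neg k (m + node_neg k n (oddz (mult m (- k + 2) k))) l =
  removable_neg k m l + (l == n)%:Z.
Proof.
move=> ko no lo k0 kn kl; rewrite /removable_neg !multD.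
case: (ltgtP n k) => nk.
- rewrite !mult_node_neg_lt //.
  have -> : (- k + 2 == n + 2) = false by lia.
  have -> : (- k == n + 2) = false by lia.
  by case: ifP => h; [|case: ifP => h']; rewrite ?andbF /= ?subr0 ?addr0 /=; lia.
- rewrite !mult_node_neg_gt //.
  have -> : (k == n) = false by lia.
  by case: ifP => h; [|case: ifP => h']; rewrite ?andbF /= ?subr0 ?addr0 /=; lia.
- subst n; rewrite !mult_node_neg_eq //.
  case par: (oddz _); move: par; rewrite /oddz.
    by case: ifP => h; [|case: ifP => h']; lia.
  by case: ifP => h; [|case: ifP => h']; lia.
Qed.

(** The first index is [k - 2] for [k > 1] and [1] for [k = 1].  There [addable_neg]
    refers to <k,k-2>, resp. <1,-1>, which is not a segment, so that its
    multiplicity stays 0 whatever is added. *)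
Lemma addable_neg_node k m n l :
  oddz k -> oddz n -> oddz l -> 0 < k -> - k + 2 <= n -> - k + 2 <= l ->
  l != k - 2 -> ~~ ((l == k) && (k == 1)) ->
  addable_neg k (m + node_neg k n (oddz (mult m (- k + 2) k))) l =
  addable_neg k m l - (l == n)%:Z.
Proof.
move=> ko no lo k0 kn kl l2 l1; rewrite /addable_neg !multD.
case: (ltgtP n k) => nk.
- rewrite !mult_node_neg_lt //.
  have -> : (- k + 2 == n + 2) = false by lia.
  by case: ifP => h; [|case: ifP => h']; rewrite ?andbF /= ?subr0 ?addr0 /=; lia.
- rewrite !mult_node_neg_gt //.
  have -> : (k == n) = false by lia.
  have -> : (k - 2 == n) = false by lia.
  by case: ifP => h; [|case: ifP => h']; rewrite ?andbF /= ?subr0 ?addr0 /=; lia.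
- subst n; rewrite !mult_node_neg_eq //.
  case par: (oddz _); move: par; rewrite /oddz.
    by case: ifP => h; [|case: ifP => h']; lia.
  by case: ifP => h; [|case: ifP => h']; lia.
Qed.

Lemma removable_F_at k m p q : oddz k ->
  removable k (F_at k (idx k p) m) (idx k q) =
  removable k m (idx k q) + (q == p)%:Z.
Proof.
move=> ko; rewrite -(idx_inj q p ko) /removable /F_at; case: ifP => k0.
  rewrite multD mult_node_pos ?oddz_idx ?idx_pos_ge //.
  by have := idx_pos_ge q k0; lia.
rewrite /node k0 /parity; have := @removable_neg_node (- k) m (idx k p) (idx k q).
rewrite opprK => -> //; rewrite ?oddzN ?oddz_idx ?idx_neg_ge //.
exact: oddz_neg_gt0.
Qed.

Lemma addable_F_at k m p q : oddz k ->
  addable k (F_at k (idx k p) m) (idx k q.+1) =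
  addable k m (idx k q.+1) - (q.+1 == p)%:Z.
Proof.
move=> ko; rewrite -(idx_inj q.+1 p ko) /addable /F_at; case: ifP => k0.
  rewrite multD mult_node_pos ?oddz_idx ?idx_pos_ge //.
  have : k + 2 <= idx k q.+1 by rewrite /idx k0; lia.
  by lia.
rewrite /node k0 /parity; have := @addable_neg_node (- k) m (idx k p) (idx k q.+1).
rewrite opprK => -> //; rewrite ?oddzN ?oddz_idx ?idx_neg_ge //.
- exact: oddz_neg_gt0.
- by rewrite /idx k0; case: ltP; lia.
- by rewrite /idx k0; case: ltP; lia.
Qed.

(** The consecutive differences change by 1 at [p] and by 1 just before [p], and
    the heights do not change far out. *)
Lemma height_F_at k m p q : oddz k ->
  height k (F_at k (idx k p) m) q =
  height k m q + (q <= p)%N%:Z + (q < p)%N%:Z.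
Proof.
move=> ko; set m' := F_at k _ m.
suff /(_ q) : forall q, height k m' q
   - (height k m q + (q <= p)%N%:Z + (q < p)%N%:Z) = 0 by lia.
apply: vanishing_seq => [|{}q].
  have [N NP] := height_eq0 k m; have [N' NP'] := height_eq0 k m'.
  by exists (N + N' + p).+1 => r rN; rewrite NP ?NP'; lia.
rewrite !(@height_step k _ q ko) removable_F_at // addable_F_at //.
lia.
Qed.

(** * Mutual inverseness at a fixed index *)

Lemma parity_node k m b : oddz k -> k < 0 ->
  parity k (m + node k (- k) b) = ~~ parity k m.
Proof.
move=> ko k0; rewrite /parity multD /node (lt_gtF k0).
rewrite mult_node_neg_eq ?oddzN ?opprK; [|done|lia].
by case: b; rewrite /oddz; lia.
Qed.

(** Away from the index [- k] with [k < 0] the node does not depend on the parity,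
    and at that index adding the node flips it. *)
Lemma node_parity k n m b : oddz k ->
  node k n (~~ parity k (m + node k n b)) = node k n (parity k m).
Proof.
move=> ko; case: (boolP ((0 < k) || (n != - k))) => [|/norP[k0 /negPn/eqP ->]].
  by rewrite /node /node_neg; case: ifP => //= _; case: ifP => // _ /negbTE ->.
by rewrite parity_node ?negbK //; have := oddz_neg_gt0 ko (negbTE k0); lia.
Qed.

Lemma F_atK k n m : oddz k -> F_at k n (E_at k n m) = m.
Proof.
move=> ko; rewrite /F_at -(node_parity _ _ (~~ parity k m) ko) /E_at subrK.
by rewrite subrK.
Qed.

Lemma E_atK k n m : oddz k -> E_at k n (F_at k n m) = m.
Proof. by move=> ko; rewrite /E_at node_parity // addrK. Qed.

(** * Stability of the restricted multisegments *)

(** The segments [seg i j] and [seg i' j'] may be 0, namely when the bounds are in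
    the wrong order, and may coincide. *)
Lemma Mtheta_exchange m i j (c : bool) i' j' (c' : bool) : Mtheta m ->
  (c -> 0 < mult m i j) -> (c' -> - j' <= i') ->
  Mtheta (m - seg i j *+ c + seg i' j' *+ c').
Proof.
move=> /MthetaP mP c0 c'0; apply/MthetaP => a b.
rewrite multD multB !multMb !mult_seg.
have [m0 mt] := mP a b.
have h : [&& c, a == i & b == j] -> 0 < mult m a b.
  by case/and3P => /c0 + /eqP -> /eqP ->.
have h' : [&& c', a == i' & b == j'] -> - b <= a.
  by case/and3P => /c'0 + /eqP -> /eqP ->.
have {}mt : mult m a b = 0 \/ - b <= a.
  by case: (eqVneq (mult m a b) 0) => [|/mt]; [left|right].
move: h h'.
by case: c c0 => c0; case: c' c'0 => c'0; case: (oddz i); case: (oddz j);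
  case: (oddz i'); case: (oddz j'); lia.
Qed.

Lemma Mtheta_replace_add m i j (c : bool) i' j' : Mtheta m ->
  (c -> 0 < mult m i j) -> - j' <= i' ->
  Mtheta (m + (seg i' j' - seg i j *+ c)).
Proof.
by move=> mM h h'; rewrite addrA addrAC; apply: (@Mtheta_exchange _ _ _ _ _ _ true).
Qed.

Lemma Mtheta_replace_sub m i j (c : bool) i' j' : Mtheta m ->
  0 < mult m i' j' -> (c -> - j <= i) ->
  Mtheta (m - (seg i' j' - seg i j *+ c)).
Proof.
by move=> mM h h'; rewrite opprB addrA addrAC; apply: (@Mtheta_exchange _ _ _ true).
Qed.

(** In the even case at [n = k], [addable_neg] is twice the multiplicity of the
    segment to be taken away.  In the odd case that segment is <-k+2,k>, which
    occurs because its multiplicity is odd. *)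
Lemma Mtheta_add_node_neg (k n : int) m : 0 < k -> - k + 2 <= n -> Mtheta m ->
  (n != k - 2 -> ~~ ((n == k) && (k == 1)) -> 0 < addable_neg k m n) ->
  Mtheta (m + node_neg k n (oddz (mult m (- k + 2) k))).
Proof.
move=> k0 kn mM; rewrite /addable_neg /node_neg.
case: (ltgtP n k) => nk ad.
- by apply: Mtheta_replace_add => //; [move=> nk2; apply: ad; lia|lia].
- by apply: (Mtheta_replace_add (c := true)) => //; [move=> _; apply: ad; lia|lia].
have m0 := mult_ge0 (- k + 2) k mM.
case: ifP ad => par ad.
  apply: (Mtheta_replace_add (c := true)) => // _.
  by rewrite lt_def m0 andbT; apply: contraTneq par => ->.
apply: Mtheta_replace_add => //; last by lia.
by move=> k1; have := ad; lia.
Qed.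

Lemma Mtheta_sub_node_neg (k n : int) m : 0 < k -> - k + 2 <= n -> Mtheta m ->
  0 < removable_neg k m n ->
  Mtheta (m - node_neg k n (~~ oddz (mult m (- k + 2) k))).
Proof.
move=> k0 kn mM; rewrite /removable_neg /node_neg.
case: (ltgtP n k) => nk re.
- by apply: Mtheta_replace_sub => //; lia.
- by apply: (Mtheta_replace_sub (c := true)) => //; lia.
have m0 := mult_ge0 (- k + 2) k mM.
case: ifPn re => [/negbTE-> re|/negPn par _].
  by apply: (Mtheta_replace_sub (c := true)) => //; lia.
apply: Mtheta_replace_sub => //; last by lia.
by rewrite lt_def m0 andbT; apply: contraTneq par => ->.
Qed.

Lemma Mtheta_F_at k m p : oddz k -> Mtheta m ->
  ((0 < p)%N -> 0 < addable k m (idx k p)) -> Mtheta (F_at k (idx k p) m).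
Proof.
move=> ko mM; rewrite /F_at /addable /node; case: ifP => k0 ad.
  apply: Mtheta_replace_add => //; last by have := idx_pos_ge p k0; lia.
  by move=> nk; apply: ad; move: nk; rewrite /idx k0; lia.
have := @Mtheta_add_node_neg (- k) (idx k p) m (oddz_neg_gt0 ko k0).
rewrite opprK; apply=> // [|n1 n2]; first exact: idx_neg_ge.
by apply: ad; move: n1 n2 (oddz_neg_gt0 ko k0); rewrite /idx k0; case: ltP; lia.
Qed.

Lemma Mtheta_E_at k m p : oddz k -> Mtheta m ->
  0 < removable k m (idx k p) -> Mtheta (E_at k (idx k p) m).
Proof.
move=> ko mM; rewrite /E_at /removable /node; case: ifP => k0 re.
  by apply: Mtheta_replace_sub => //; have := idx_pos_ge p k0; lia.
have := @Mtheta_sub_node_neg (- k) (idx k p) m (oddz_neg_gt0 ko k0).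
by rewrite opprK; apply=> //; exact: idx_neg_ge.
Qed.

(** * Extremal maxima of eventually zero sequences *)

(** The truth value in the inequality makes it strict on one side of [n]: [n] is
    then the first, resp. the last, place where [a] is maximal. *)
Definition first_peak (a : nat -> int) (n : nat) :=
  forall p, a p + (p < n)%N%:Z <= a n.

Definition last_peak (a : nat -> int) (n : nat) :=
  forall p, a p + (n < p)%N%:Z <= a n.

(** Adding 2 before [n] and 1 at [n] turns the strict inequalities before [n] into
    weak ones relative to [n], and the weak ones after [n] into strict ones. *)
Lemma peak_shift (a a' : nat -> int) n :
  (forall p, a' p = a p + (p <= n)%N%:Z + (p < n)%N%:Z) ->
  first_peak a n <-> last_peak a' n.
Proof.
by move=> aE; split=> h p; move: (h p); rewrite !aE; lia.
Qed.

Lemma max_exists (a : nat -> int) :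
  (exists N, forall p, (N <= p)%N -> a p = 0) -> exists n, forall p, a p <= a n.
Proof.
move=> [N aN].
case: (@arg_maxP _ _ _ (ord0 : 'I_N.+1) predT (fun i => a i)) => // i _ iP.
exists i => p; case: (ltnP p N.+1) => pN; first exact: (iP (Ordinal pN)).
by have := iP ord_max isT; rewrite /= (aN N (leqnn N)) (aN p (ltnW pN)).
Qed.

Lemma first_peak_exists (a : nat -> int) :
  (exists N, forall p, (N <= p)%N -> a p = 0) -> exists n, first_peak a n.
Proof.
move=> /max_exists[n0 n0P].
have ex : exists n, a n == a n0 by exists n0.
case: (ex_minnP ex) => n /eqP an nP; exists n => p.
rewrite an; move: (n0P p) (nP p); case: ltnP => pn; last by lia.
case: eqVneq => [_ _ /(_ isT)|]; lia.
Qed.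

(** A positive maximum is attained only finitely often; a maximum equal to 0 would
    be attained at all large indices, and there would be no last one. *)
Lemma last_peak_exists (a : nat -> int) n0 :
  (exists N, forall p, (N <= p)%N -> a p = 0) ->
  (forall p, a p <= a n0) -> 0 < a n0 -> exists n, last_peak a n.
Proof.
move=> [N aN] n0P a0.
have ex : exists n, a n == a n0 by exists n0.
have bd n : a n == a n0 -> (n <= N)%N.
  by move=> /eqP an; rewrite leqNgt; apply/negP => /ltnW/aN; lia.
case: (ex_maxnP ex bd) => n /eqP an nP; exists n => p.
rewrite an; move: (n0P p) (nP p); case: ltnP => pn; last by lia.
case: eqVneq => [_ _ /(_ isT)|]; lia.
Qed.

(** * The crystal structure *)

Lemma eps_height k m n : oddz k ->
  (forall p, height k m p <= height k m n) -> eps k m = height k m n.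
Proof.
move=> ko hn; apply: xget_unique => [|y [[l /(idx_surj ko)[p ->] <-] ub]].
  split; first by exists (idx k n) => //; exact: idx_indices.
  by move=> _ [l /(idx_surj ko)[p ->] <-]; exact: hn.
apply/eqP; rewrite eq_le (hn p) /=; apply: ub.
by exists (idx k n) => //; exact: idx_indices.
Qed.

Lemma nf_first_peak k m n : oddz k -> first_peak (height k m) n ->
  eps k m = height k m n /\ nf k m = idx k n.
Proof.
move=> ko hn; have en : eps k m = height k m n.
  by apply: eps_height => // p; move: (hn p); lia.
have an : argmaxA k m (idx k n) by split; [exact: idx_indices|].
have nP l : argmaxA k m l -> leind k (idx k n) l.
  move=> [/(idx_surj ko)[p ->]]; rewrite en -/(height k m p) => e.
  by rewrite leind_idx // leqNgt; move: (hn p); case: ltnP; lia.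
split=> //; apply: xget_unique => // l [al lP].
have [/(idx_surj ko)[p lp] _] := al; subst l.
by apply: leind_anti => //; [exact: lP|exact: nP].
Qed.

Lemma ne_last_peak k m n : oddz k -> last_peak (height k m) n ->
  eps k m = height k m n /\ ne k m = idx k n.
Proof.
move=> ko hn; have en : eps k m = height k m n.
  by apply: eps_height => // p; move: (hn p); lia.
have an : argmaxA k m (idx k n) by split; [exact: idx_indices|].
have nP l : argmaxA k m l -> leind k l (idx k n).
  move=> [/(idx_surj ko)[p ->]]; rewrite en -/(height k m p) => e.
  by rewrite leind_idx // leqNgt; move: (hn p); case: ltnP; lia.
split=> //; apply: xget_unique => // l [al lP].
have [/(idx_surj ko)[p lp] _] := al; subst l.
by apply: leind_anti => //; [exact: nP|exact: lP].
Qed.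

(** The heights are 0 far out, so their maximum cannot be negative. *)
Lemma eps_ge0 k m : oddz k -> 0 <= eps k m.
Proof.
move=> ko; have [n hn] := first_peak_exists (height_eq0 k m).
have [-> _] := nf_first_peak ko hn; have [N NP] := height_eq0 k m.
by move: (hn N); rewrite NP //; lia.
Qed.

Lemma Ft_crystal k m : oddz k -> Mtheta m ->
  Mtheta (Ft k m) /\ Et k (Ft k m) = Some m.
Proof.
move=> ko mM; have [n hn] := first_peak_exists (height_eq0 k m).
have [en fn] := nf_first_peak ko hn; rewrite Ft_F_at fn; split.
  (* The height increases strictly from [p] to the first maximum [p.+1]. *)
  apply: Mtheta_F_at => //; case: n hn {en fn} => // p hn _.
  have := removable_ge0 k (idx k p) mM; have := height_step m p ko.
  by move: (hn p); rewrite ltnSn; lia.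
have hF q := @height_F_at k m n q ko.
have [eF nF] := ne_last_peak ko ((peak_shift hF).1 hn).
rewrite Et_E_at eF nF hF leqnn ltnn -en; have e0 := eps_ge0 m ko.
by rewrite ifT ?E_atK //; lia.
Qed.

Lemma Et_crystal k m : oddz k -> Mtheta m -> 0 < eps k m ->
  exists m', [/\ Et k m = Some m', Mtheta m', Ft k m' = m
               & eps k m' = eps k m - 1].
Proof.
move=> ko mM e0; have [n0 hn0] := first_peak_exists (height_eq0 k m).
have [en0 _] := nf_first_peak ko hn0.
have [||n hn] := @last_peak_exists (height k m) n0 (height_eq0 k m).
- by move=> p; move: (hn0 p); lia.
- by rewrite -en0.
have [en nn] := ne_last_peak ko hn.
have hE q : height k m q = height k (E_at k (idx k n) m) q
                           + (q <= n)%N%:Z + (q < n)%N%:Z.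
  by rewrite -height_F_at // F_atK.
have [eE nE] := nf_first_peak ko ((peak_shift hE).2 hn).
exists (E_at k (idx k n) m); split.
- by rewrite Et_E_at e0 nn.
- (* The height decreases strictly after the last maximum [n]. *)
  apply: Mtheta_E_at => //.
  have := addable_ge0 k (idx k n.+1) mM; have := height_step m n ko.
  by move: (hn n.+1); rewrite ltnSn; lia.
- by rewrite Ft_F_at nE F_atK.
- by rewrite eE en hE leqnn ltnn; lia.
Qed.

(** Each application of [Et] lowers [eps] by one, and [Et] is undefined exactly
    when [eps] is 0. *)
Lemma Et_iter_eps k m : oddz k -> Mtheta m ->
  exists n : nat, eps k m = n%:Z /\
    forall p, Et_iter k p m <> None <-> (p <= n)%N.
Proof.
move=> ko mM; exists (absz (eps k m)); split; first by have := eps_ge0 m ko; lia.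
have: eps k m = (absz (eps k m))%:Z by have := eps_ge0 m ko; lia.
move: (absz _) => n; elim: n m mM => [|n IHn] m mM en [|p] //.
  rewrite /Et_iter iterSr /= /Et en ltxx.
  by have -> : iter p (obind (Et k)) None = None by elim: p => //= p ->.
have [|m' [EtE m'M _ eE]] := @Et_crystal k m ko mM; first by rewrite en.
by rewrite /Et_iter iterSr /= EtE; apply: IHn => //; rewrite eE en; lia.
Qed.

Theorem theorem5p7 (k : int) (hk : oddz k) :
  ((forall m : lcomb, Mtheta m -> Mtheta (Ft k m)) /\
   (forall m m' : lcomb, Mtheta m -> Et k m = Some m' -> Mtheta m')) /\
  ((forall m m' : lcomb, Mtheta m -> Et k m = Some m' -> Ft k m' = m) /\
   (forall m : lcomb, Mtheta m -> Et k (Ft k m) = Some m)) /\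
  (forall m : lcomb, Mtheta m ->
     exists n : nat, eps k m = n%:Z /\ Et_iter k n m <> None /\
       (forall p : nat, Et_iter k p m <> None -> (p <= n)%N)).
Proof.
have EtP m m' : Mtheta m -> Et k m = Some m' -> Mtheta m' /\ Ft k m' = m.
  move=> mM; case: (ltP 0 (eps k m)) => [e0|e0]; last by rewrite /Et ltNge e0.
  by have [m1 [-> m1M Fm1 _]] := Et_crystal hk mM e0; case=> <-.
split; [split=> m|split; [split=> m|]].
- by case/(Ft_crystal hk).
- by move=> m' mM /(EtP _ _ mM)[].
- by move=> m' mM /(EtP _ _ mM)[].
- by case/(Ft_crystal hk).
move=> m /(Et_iter_eps hk)[n [en nP]].
by exists n; split=> //; split=> [|p]; [exact/nP|move/nP].
Qed.
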